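(* Assume that all of the following hold. (i) There exist $\alpha_{\mathrm{lo}}^T,\alpha_{\mathrm{up}}^T\in\mathcal{K}_\infty$ such that $\alpha_{\mathrm{lo}}^T(|r|_{r_{\mathrm d}})\le T(r)\le \alpha_{\mathrm{up}}^T(|r|_{r_{\mathrm d}})$ for all $r\in\mathcal{R}$. (ii) There exist $c_1^\ell,c_2^\ell>0$ such that $c_1^\ell|x|_{x_r}^2\le\bar\ell(x,r)\le c_2^\ell|x|_{x_r}^2$ for all $(x,u)\in\mathcal{Z}$ and $r=(x_r,u_r)\in\mathcal{R}$. (iii) There exist $c_3^\ell,c_4^\ell>0$ such that $\ell(x,u,r_1)\le c_3^\ell\,\ell(x,u,r_2)+c_4^\ell|r_1|_{r_2}^2$ for all $r_1,r_2\in\mathcal{R}$, $(x,u)\in\mathcal{Z}$. (iv) There exist $c_5^\ell,c_6^\ell>0$ such that $\ell(x,u,r_1)\le \ell(x,u,r_2)+c_5^\ell|r_1|_{r_2}^2+c_6^\ell|r_1|_{r_2}$ for all $r_1,r_2\in\mathcal{R}$, $(x,u)\in\mathcal{Z}$. (v) There exist $c_{\mathrm b},c_{\mathrm f}>0$ and a map $k_{\mathrm f}:X\times\mathcal{R}\to\mathbb{R}^m$ such that the terminal cost $V^{\mathrm f}$ is continuous, the terminal sets $\mathcal{X}^{\mathrm f}(r)\subseteq X$ are compact, and for any $r=(x_r,u_r)\in\mathcal{R}$ and any $x\in\mathcal{X}^{\mathrm f}(r)$, with $x^+=f(x,k_{\mathrm f}(x,r))$: $x^+\in\mathcal{X}^{\mathrm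 f}(r)$; $V^{\mathrm f}(x^+,r)-V^{\mathrm f}(x,r)\le-\ell(x,k_{\mathrm f}(x,r),r)$; $(x,k_{\mathrm f}(x,r))\in\mathcal{Z}$; $\mathcal{B}_{c_{\mathrm b}}(x_r)\subseteq\mathcal{X}^{\mathrm f}(r)$; $V^{\mathrm f}(x,r)\le c_{\mathrm f}\bar\ell(x,r)$. (vi) $\lambda(N)\ge N$ for all $N\in\mathbb{N}_0$ and $\lambda(0)\ge1$. (vii) There exist $c_1^{\mathrm r},c_2^{\mathrm r}>0$ such that for any $r\in\mathcal{R}$ and any $\theta\in[0,1]$ there exists $\hat r\in\mathcal{R}$ with $|\hat r|_r\le c_1^{\mathrm r}\theta|r|_{r_{\mathrm d}}$ and $T(\hat r)-T(r)\le-c_2^{\mathrm r}\theta|r|_{r_{\mathrm d}}^2$. Then, for any $\widetilde N\in\mathbb{N}$ and any $x\in\mathcal{X}_{\widetilde N}$, $$\lim_{\substack{N\to\infty \\ K\to\infty}}J_K^{\mathrm d}(x,\mu_N)\le\inf_{u\in\mathbb{U}^\infty_{\{x_{\mathrm d}\}}(x)}J_\infty^{\mathrm d}(x,u).$$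
   Context: Notation. $\mathbb{N}$ are the positive integers, $\mathbb{N}_0=\mathbb{N}\cup\{0\}$, $\mathbb{I}_{a:b}$ the integers from $a$ to $b$. For vectors, $|v|_{v'}=\|v-v'\|_2$ (Euclidean distance); for a closed set $\mathbb{X}$, $|v|_{\mathbb{X}}$ is the Euclidean distance of $v$ to $\mathbb{X}$. $\mathcal{B}_c(\tilde x)=\{x\in\mathbb{R}^n\mid\|x-\tilde x\|_2\le c\}$. $\mathcal{K}_\infty$: continuous, strictly increasing, unbounded functions $\alpha:\mathbb{R}_{\ge0}\to\mathbb{R}_{\ge0}$ with $\alpha(0)=0$. System. $x(t+1)=f(x(t),u(t))$ with $f:\mathbb{R}^n\times\mathbb{R}^m\to\mathbb{R}^n$ continuous, $x(t)\in X\subset\mathbb{R}^n$ bounded, $u(t)\in U\subset\mathbb{R}^m$ compact, and constraints $(x(t),u(t))\in\mathcal{Z}$ with $\mathcal{Z}\subseteq X\times U$ compact. For $x\in X$ and $u\in U^K$ ($K\in\mathbb{N}_0\cup\{\infty\}$), $x_u(k,x)$ is the solution: $x_u(0,x)=x$, $x_u(k+1,x)=f(x_u(k,x),u(k))$. The sequence $u$ is admissible if $(x_u(k,x),u(k))\in\mathcal{Z}$ for all $0\le k<K$ and, for finite $K$, $x_u(K,x)\in X$. For a closed set $\mathbb{X}$, $\mathbb{U}^K_{\mathbb{X}}(x)$ is the set of admissible $u\in U^K$ with $x_u(K,x)\in\mathbb{X}$ if $K<\infty$, and with $\lim_{k\to\infty}|x_u(k,x)|_{\mathbb{X}}=0$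 if $K=\infty$. The infimum over the empty set is $+\infty$. References. $\mathcal{Z}_{\mathrm r}\subseteq\mathrm{int}\,\mathcal{Z}$ is closed and $\mathcal{R}=\{(x,u)\in\mathcal{Z}_{\mathrm r}\mid x=f(x,u)\}$. For $r=(x_r,u_r),\hat r=(x_{\hat r},u_{\hat r})\in\mathcal{R}$, $|r|_{\hat r}=\sqrt{|x_r|_{x_{\hat r}}^2+|u_r|_{u_{\hat r}}^2}$. $T$ is a real-valued offset cost (attaining its overall minimum at an external reference $r_{\mathrm e}$, possibly not in $\mathcal{R}$). The best reachable reference $r_{\mathrm d}=(x_{\mathrm d},u_{\mathrm d})=\arg\min_{r\in\mathcal{R}}T(r)$ is assumed unique, with $T(r_{\mathrm d})=0$. Costs. $\ell:X\times U\times\mathcal{R}\to\mathbb{R}_{\ge0}$ is the stage cost, $\bar\ell(x,r)=\min_{u\in U,\,(x,u)\in\mathcal{Z}}\ell(x,u,r)$, $V^{\mathrm f}:X\times\mathcal{R}\to\mathbb{R}_{\ge0}$ the terminal cost, $\mathcal{X}^{\mathrm f}(r)\subseteq X$ ($r\in\mathcal{R}$) the terminal sets, $\lambda:\mathbb{N}_0\to\mathbb{R}_{\ge0}$ the scaling function. $J_N^{\mathrm{tc}}(x,u,r)=\sum_{k=0}^{N-1}\ell(x_u(k,x),u(k),r)+V^{\mathrm f}(x_u(N,x),r)$ and $J_K^{\mathrm d}(x,u)=\sum_{k=0}^{K-1}\ell(x_u(k,x),u(k),r_{\mathrm d})$ for $K\in\mathbb{N}_0\cup\{\infty\}$. MPC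 for tracking with horizon $N$: $V_N(x)=\min\{J_N^{\mathrm{tc}}(x,u,r)+\lambda(N)T(r)\mid r\in\mathcal{R},\,u\in\mathbb{U}^N_{\mathcal{X}^{\mathrm f}(r)}(x)\}$; $\mathcal{X}_N$ is the set of states for which this problem is feasible; $(u_N^*,r_N^*(x))$ denotes its optimal solution (minimisers are taken to exist whenever the problem is feasible); $\mu_N(x)=u_N^*(0)$ is the first element of the optimal input sequence; $x_{\mu_N}(k,x)$ is the solution of the closed loop $x(t+1)=f(x(t),\mu_N(x(t)))$ with $x(0)=x$. The closed-loop performance is $J_K^{\mathrm d}(x,\mu_N)=\sum_{k=0}^{K-1}\ell\big(x_{\mu_N}(k,x),\mu_N(x_{\mu_N}(k,x)),r_{\mathrm d}\big)$. *)

(* Defs.v *)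
From HB Require Import structures.
From mathcomp Require Import all_boot all_order all_algebra.
From mathcomp Require Import all_classical all_reals all_analysis.

Set Implicit Arguments.
Unset Strict Implicit.
Unset Printing Implicit Defensive.

Import Order.TTheory GRing.Theory Num.Theory.
Import numFieldNormedType.Exports.

Local Open Scope classical_set_scope.
Local Open Scope ring_scope.

(* The library norm on row vectors is the sup norm, whereas the costs below are
   measured in the Euclidean one; both induce the same topology, so open,
   closed, compact and continuous are the library notions. *)
Definition eucl_norm (R : realType) (n : nat) (v : 'rV[R]_n) : R :=
  Num.sqrt (\sum_(i < n) v 0 i ^+ 2).

Definition eucl_dist (R : realType) (n : nat) (v w : 'rV[R]_n) : R :=
  eucl_norm (v - w).

Definition eucl_dist_set (R : realType) (n : nat) (v : 'rV[R]_n)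
    (A : set 'rV[R]_n) : R :=
  inf [set eucl_dist v w | w in A].

Definition eucl_cball (R : realType) (n : nat) (c : R) (z : 'rV[R]_n) :
    set 'rV[R]_n :=
  [set x | eucl_dist x z <= c].

Definition ref_dist (R : realType) (n m : nat) (r s : 'rV[R]_n * 'rV[R]_m) : R :=
  Num.sqrt (eucl_dist r.1 s.1 ^+ 2 + eucl_dist r.2 s.2 ^+ 2).

(* Only the restriction of [a] to the nonnegative reals matters; nonnegativity
   of its values there follows from [a 0 = 0] and monotonicity. *)
Definition class_Kinf (R : realType) (a : R -> R) : Prop :=
  [/\ {within `[0, +oo[, continuous a},
      (forall s t : R, 0 <= s -> s < t -> a s < a t),
      a 0 = 0
    & forall M : R, exists2 s : R, 0 <= s & M < a s].

Definition is_min (R : realType) (A : set R) (v : R) : Prop :=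
  A v /\ forall w, A w -> v <= w.

Definition unique_argmin (R : realType) (A : Type) (T : A -> R) (S : set A)
    (r0 : A) : Prop :=
  [/\ S r0,
      (forall r, S r -> T r0 <= T r)
    & (forall r, S r -> (forall s, S s -> T r <= T s) -> r = r0)].

Definition references (R : realType) (n m : nat)
    (f : 'rV[R]_n * 'rV[R]_m -> 'rV[R]_n)
    (Zr : set ('rV[R]_n * 'rV[R]_m)) : set ('rV[R]_n * 'rV[R]_m) :=
  [set r | Zr r /\ r.1 = f r].

(* Input sequences of any length are functions on [nat]; for a finite horizon
   K only the values [u 0, ..., u (K - 1)] are constrained and used. *)
Fixpoint traj (R : realType) (n m : nat)
    (f : 'rV[R]_n * 'rV[R]_m -> 'rV[R]_n) (u : nat -> 'rV[R]_m)
    (x : 'rV[R]_n) (k : nat) : 'rV[R]_n :=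
  if k is k'.+1 then f (traj f u x k', u k') else x.

Definition inputs_to (R : realType) (n m : nat)
    (f : 'rV[R]_n * 'rV[R]_m -> 'rV[R]_n) (X : set 'rV[R]_n)
    (U : set 'rV[R]_m) (Z : set ('rV[R]_n * 'rV[R]_m)) (K : nat)
    (A : set 'rV[R]_n) (x : 'rV[R]_n) : set (nat -> 'rV[R]_m) :=
  [set u | [/\ (forall k, (k < K)%N -> U (u k)),
               (forall k, (k < K)%N -> Z (traj f u x k, u k)),
               X (traj f u x K)
             & A (traj f u x K)]].

Definition inputs_to_inf (R : realType) (n m : nat)
    (f : 'rV[R]_n * 'rV[R]_m -> 'rV[R]_n)
    (U : set 'rV[R]_m) (Z : set ('rV[R]_n * 'rV[R]_m))
    (A : set 'rV[R]_n) (x : 'rV[R]_n) : set (nat -> 'rV[R]_m) :=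
  [set u | [/\ (forall k, U (u k)),
               (forall k, Z (traj f u x k, u k))
             & eucl_dist_set (traj f u x k) A @[k --> \oo] --> (0 : R)]].

Definition Jtc (R : realType) (n m : nat)
    (f : 'rV[R]_n * 'rV[R]_m -> 'rV[R]_n)
    (l : 'rV[R]_n -> 'rV[R]_m -> 'rV[R]_n * 'rV[R]_m -> R)
    (Vf : 'rV[R]_n -> 'rV[R]_n * 'rV[R]_m -> R) (N : nat)
    (x : 'rV[R]_n) (u : nat -> 'rV[R]_m) (r : 'rV[R]_n * 'rV[R]_m) : R :=
  \sum_(0 <= k < N) l (traj f u x k) (u k) r + Vf (traj f u x N) r.

Definition Jd_inf (R : realType) (n m : nat)
    (f : 'rV[R]_n * 'rV[R]_m -> 'rV[R]_n)
    (l : 'rV[R]_n -> 'rV[R]_m -> 'rV[R]_n * 'rV[R]_m -> R)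
    (rd : 'rV[R]_n * 'rV[R]_m)
    (x : 'rV[R]_n) (u : nat -> 'rV[R]_m) : \bar R :=
  (\sum_(0 <= k <oo) (l (traj f u x k) (u k) rd)%:E)%E.

Definition mpc_candidates (R : realType) (n m : nat)
    (f : 'rV[R]_n * 'rV[R]_m -> 'rV[R]_n) (X : set 'rV[R]_n)
    (U : set 'rV[R]_m) (Z Zr : set ('rV[R]_n * 'rV[R]_m))
    (Xf : 'rV[R]_n * 'rV[R]_m -> set 'rV[R]_n) (N : nat) (x : 'rV[R]_n) :
    set ((nat -> 'rV[R]_m) * ('rV[R]_n * 'rV[R]_m)) :=
  [set p | references f Zr p.2 /\ inputs_to f X U Z N (Xf p.2) x p.1].

Definition mpc_feasible (R : realType) (n m : nat)
    (f : 'rV[R]_n * 'rV[R]_m -> 'rV[R]_n) (X : set 'rV[R]_n)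
    (U : set 'rV[R]_m) (Z Zr : set ('rV[R]_n * 'rV[R]_m))
    (Xf : 'rV[R]_n * 'rV[R]_m -> set 'rV[R]_n) (N : nat) : set 'rV[R]_n :=
  [set x | X x /\ mpc_candidates f X U Z Zr Xf N x !=set0].

Definition mpc_cost (R : realType) (n m : nat)
    (f : 'rV[R]_n * 'rV[R]_m -> 'rV[R]_n)
    (l : 'rV[R]_n -> 'rV[R]_m -> 'rV[R]_n * 'rV[R]_m -> R)
    (Vf : 'rV[R]_n -> 'rV[R]_n * 'rV[R]_m -> R)
    (T : 'rV[R]_n * 'rV[R]_m -> R) (lam : nat -> R) (N : nat)
    (x : 'rV[R]_n) (p : (nat -> 'rV[R]_m) * ('rV[R]_n * 'rV[R]_m)) : R :=
  Jtc f l Vf N x p.1 p.2 + lam N * T p.2.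

Definition mpc_optimal (R : realType) (n m : nat)
    (f : 'rV[R]_n * 'rV[R]_m -> 'rV[R]_n) (X : set 'rV[R]_n)
    (U : set 'rV[R]_m) (Z Zr : set ('rV[R]_n * 'rV[R]_m))
    (l : 'rV[R]_n -> 'rV[R]_m -> 'rV[R]_n * 'rV[R]_m -> R)
    (Vf : 'rV[R]_n -> 'rV[R]_n * 'rV[R]_m -> R)
    (Xf : 'rV[R]_n * 'rV[R]_m -> set 'rV[R]_n)
    (T : 'rV[R]_n * 'rV[R]_m -> R) (lam : nat -> R) (N : nat)
    (x : 'rV[R]_n) (p : (nat -> 'rV[R]_m) * ('rV[R]_n * 'rV[R]_m)) : Prop :=
  mpc_candidates f X U Z Zr Xf N x p /\
  forall q, mpc_candidates f X U Z Zr Xf N x q ->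
    mpc_cost f l Vf T lam N x p <= mpc_cost f l Vf T lam N x q.

(* [sol N x] is the selected optimal pair (input sequence, reference) of the
   horizon-N problem at [x]. *)
Definition mpc_law (R : realType) (n m : nat)
    (sol : nat -> 'rV[R]_n ->
           (nat -> 'rV[R]_m) * ('rV[R]_n * 'rV[R]_m))
    (N : nat) (x : 'rV[R]_n) : 'rV[R]_m :=
  (sol N x).1 0%N.

Definition closed_loop (R : realType) (n m : nat)
    (f : 'rV[R]_n * 'rV[R]_m -> 'rV[R]_n) (mu : 'rV[R]_n -> 'rV[R]_m)
    (k : nat) (x : 'rV[R]_n) : 'rV[R]_n :=
  iter k (fun y => f (y, mu y)) x.

Definition Jd_cl (R : realType) (n m : nat)
    (f : 'rV[R]_n * 'rV[R]_m -> 'rV[R]_n)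
    (l : 'rV[R]_n -> 'rV[R]_m -> 'rV[R]_n * 'rV[R]_m -> R)
    (rd : 'rV[R]_n * 'rV[R]_m) (mu : 'rV[R]_n -> 'rV[R]_m)
    (K : nat) (x : 'rV[R]_n) : R :=
  \sum_(0 <= k < K)
    l (closed_loop f mu k x) (mu (closed_loop f mu k x)) rd.

(* Main.v *)
(* The limit exists and equals the infimum J on the right.
   Steering through intermediate references supplied by (vii) shows that J is
   finite. Since lambda(N) T(r_d) = 0, for large N the value V_N(x) is at most
   J + eps; it decreases along the closed loop by the stage cost measured at the
   current optimal reference r_N. By (vii) and optimality, |r_N|_{r_d}^2 is bounded
   by a multiple of that stage cost, so with (iii) the stage cost at r_d is too,
   with constants independent of N. Hence the tails of the closed-loop cost and
   the distance to x_d are small after a number of steps independent of N.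
   Upper bound: over a fixed number of steps r_N converges to r_d as N grows,
   because N T(r_N) <= V_N(x), and (iv) compares the two stage costs. Lower bound:
   the closed loop followed by the terminal law at r_d is an admissible input. *)

Require Import Defs.
From HB Require Import structures.
From mathcomp Require Import all_boot all_order all_algebra.
From mathcomp Require Import all_classical all_reals all_analysis.
From mathcomp Require Import ring lra.

Set Implicit Arguments.
Unset Strict Implicit.
Unset Printing Implicit Defensive.

Import Order.TTheory GRing.Theory Num.Theory.
Import numFieldNormedType.Exports.

Local Open Scope classical_set_scope.
Local Open Scope ring_scope.

(** * Euclidean distances, elementary estimates and trajectories *)

Section Preliminaries.
Variable R : realType.

Lemma eucl_dist_ge0 n (v w : 'rV[R]_n) : 0 <= eucl_dist v w.
Proof. exact: sqrtr_ge0. Qed.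

Lemma eucl_dist_sqr n (v w : 'rV[R]_n) :
  eucl_dist v w ^+ 2 = \sum_(i < n) (v 0 i - w 0 i) ^+ 2.
Proof.
rewrite /eucl_dist /eucl_norm sqr_sqrtr ?sumr_ge0 // => [|i _]; last exact: sqr_ge0.
by apply: eq_bigr => i _; rewrite !mxE.
Qed.

Lemma eucl_dist_sqrC n (v w : 'rV[R]_n) : eucl_dist v w ^+ 2 = eucl_dist w v ^+ 2.
Proof. by rewrite !eucl_dist_sqr; apply: eq_bigr => i _; rewrite -opprB sqrrN. Qed.

(* Only squared distances are compared below, up to constant factors, so this
   replaces the Euclidean triangle inequality. *)
Lemma eucl_dist_sqr_triangle n (y x z : 'rV[R]_n) :
  eucl_dist x z ^+ 2 <= 2 * (eucl_dist x y ^+ 2 + eucl_dist y z ^+ 2).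
Proof.
rewrite !eucl_dist_sqr -big_split mulr_sumr ler_sum // => i _ /=.
have := sqr_ge0 (x 0 i - y 0 i - (y 0 i - z 0 i)); nra.
Qed.

Lemma eucl_dist_sqr_bounded n (A : set 'rV[R]_n) : bounded_set A ->
  exists B, forall v w, A v -> A w -> eucl_dist v w ^+ 2 <= B.
Proof.
move=> [M [_ /(_ (M + 1))]]; rewrite ltrDl => /(_ ltr01) AM.
have entry v i : A v -> `|v 0 i| <= M + 1.
  move=> /AM; apply: le_trans.
  by rewrite /Num.norm/= mx_normrE; apply: (le_bigmax _ (fun i => `|v i.1 i.2|) (0, i)).
exists (\sum_(i < n) (2 * (M + 1)) ^+ 2) => v w Av Aw.
rewrite eucl_dist_sqr ler_sum // => i _.
have := entry v i Av; have := entry w i Aw; rewrite !ler_norml => /andP[? ?] /andP[? ?].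
nra.
Qed.

Lemma ref_dist_ge0 n m (r s : 'rV[R]_n * 'rV[R]_m) : 0 <= ref_dist r s.
Proof. exact: sqrtr_ge0. Qed.

Lemma ref_dist_sqr n m (r s : 'rV[R]_n * 'rV[R]_m) :
  ref_dist r s ^+ 2 = eucl_dist r.1 s.1 ^+ 2 + eucl_dist r.2 s.2 ^+ 2.
Proof. by rewrite sqr_sqrtr // addr_ge0 // sqr_ge0. Qed.

Lemma eucl_dist1_le n m (r s : 'rV[R]_n * 'rV[R]_m) :
  eucl_dist r.1 s.1 ^+ 2 <= ref_dist r s ^+ 2.
Proof. by rewrite ref_dist_sqr lerDl sqr_ge0. Qed.

Lemma ref_distC n m (r s : 'rV[R]_n * 'rV[R]_m) : ref_dist r s = ref_dist s r.
Proof.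
by rewrite /ref_dist (eucl_dist_sqrC r.1) (eucl_dist_sqrC r.2).
Qed.

Lemma exists_natr_gt (a e : R) : 0 < e -> exists K : nat, a < K%:R * e.
Proof.
move=> e0; exists (Num.trunc (`|a| / e)).+1; rewrite -ltr_pdivrMr //.
apply: le_lt_trans (truncnS_gt _).
by rewrite ler_pM2r ?invr_gt0 // ler_norm.
Qed.

(** Pigeonhole in place of a summability argument: the number of terms to inspect depends only on
    [B] and [e], not on the sequence, and this makes the later bounds uniform in the horizon. *)
Lemma exists_small_term (a : nat -> R) (B e : R) K :
  \sum_(0 <= k < K) a k <= B -> B < K%:R * e -> exists2 k, (k < K)%N & a k <= e.
Proof.
move=> aB Be; apply/not_exists2P => /= H.
have: K%:R * e <= \sum_(0 <= k < K) a k.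
  rewrite -[K in K%:R]subn0 mulr_natl -sumr_const_nat !big_mkord ler_sum // => i _.
  by have [|/negP] := H i; [rewrite ltn_ord|rewrite -ltNge => /ltW].
lra.
Qed.

Lemma exists_small_step (a a' b b' : R) : 0 < b -> 0 < b' ->
  exists t, [/\ 0 < t, t <= 1, a * t <= b & a' * t <= b'].
Proof.
move=> b0 b'0; have A (x : R) : 0 < `|x| + 1 by rewrite ltr_wpDl.
(* The denominators [|a| + 1] are positive, so no sign or vanishing case of [a], [a'] arises. *)
pose t := Num.min 1 (Num.min (b / (`|a| + 1)) (b' / (`|a'| + 1))).
have t0 : 0 < t by rewrite !lt_min ltr01 !divr_gt0.
have : t <= Num.min 1 (Num.min (b / (`|a| + 1)) (b' / (`|a'| + 1))) by [].
rewrite !le_min !ler_pdivlMr // => /and3P[t1 tb tb'].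
have := ler_norm a; have := ler_norm a'; exists t; split=> //; nra.
Qed.

Lemma traj_closed_loop n m (f : 'rV[R]_n * 'rV[R]_m -> 'rV[R]_n) mu y k :
  traj f (fun j => mu (closed_loop f mu j y)) y k = closed_loop f mu k y.
Proof. by elim: k => //= k ->. Qed.

Lemma traj_cons n m (f : 'rV[R]_n * 'rV[R]_m -> 'rV[R]_n) v u y k :
  traj f (fun j => if j is i.+1 then u i else v) y k.+1 = traj f u (f (y, v)) k.
Proof. by elim: k => //= k <-. Qed.

Lemma traj_ext n m (f : 'rV[R]_n * 'rV[R]_m -> 'rV[R]_n) u u' y k :
  (forall j, (j < k)%N -> u j = u' j) -> traj f u y k = traj f u' y k.
Proof.
elim: k => //= k IH uu'; rewrite IH ?uu' // => j jk.
by rewrite uu' // ltnS ltnW.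
Qed.

End Preliminaries.

Section Tracking.
Variables (R : realType) (n m : nat).
Variable f : 'rV[R]_n * 'rV[R]_m -> 'rV[R]_n.
Variables (X : set 'rV[R]_n) (U : set 'rV[R]_m) (Z Zr : set ('rV[R]_n * 'rV[R]_m)).
Hypothesis Z_sub : Z `<=` X `*` U.
Variables (T : 'rV[R]_n * 'rV[R]_m -> R) (rd : 'rV[R]_n * 'rV[R]_m).
Local Notation Ref := (references f Zr).
Hypothesis rd_ref : Ref rd.
Hypothesis T_rd : T rd = 0.
Hypothesis T_ge0 : forall r, Ref r -> 0 <= T r.
Variables (l : 'rV[R]_n -> 'rV[R]_m -> 'rV[R]_n * 'rV[R]_m -> R).
Variables (lbar Vf : 'rV[R]_n -> 'rV[R]_n * 'rV[R]_m -> R).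
Variable Xf : 'rV[R]_n * 'rV[R]_m -> set 'rV[R]_n.
Hypothesis l_ge0 : forall x u r, Z (x, u) -> Ref r -> 0 <= l x u r.
Hypothesis lbar_le : forall x u r, Z (x, u) -> Ref r -> lbar x r <= l x u r.
Hypothesis Vf_ge0 : forall x r, X x -> Ref r -> 0 <= Vf x r.
Hypothesis Xf_sub : forall r, Ref r -> Xf r `<=` X.

Variable alo : R -> R.
Hypothesis alo0 : alo 0 = 0.
Hypothesis alo_incr : forall s t : R, 0 <= s -> s < t -> alo s < alo t.
Hypothesis T_lower : forall r, Ref r -> alo (ref_dist r rd) <= T r.

Variables c1 c2 c3 c4 c5 c6 : R.
Hypotheses (c1_gt0 : 0 < c1) (c2_gt0 : 0 < c2) (c3_gt0 : 0 < c3).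
Hypotheses (c4_gt0 : 0 < c4) (c5_gt0 : 0 < c5) (c6_gt0 : 0 < c6).
Hypothesis lbar_quad : forall x u r, Z (x, u) -> Ref r ->
  c1 * eucl_dist x r.1 ^+ 2 <= lbar x r <= c2 * eucl_dist x r.1 ^+ 2.
Hypothesis l_quad : forall r1 r2 x u, Ref r1 -> Ref r2 -> Z (x, u) ->
  l x u r1 <= c3 * l x u r2 + c4 * ref_dist r1 r2 ^+ 2.
Hypothesis l_lin : forall r1 r2 x u, Ref r1 -> Ref r2 -> Z (x, u) ->
  l x u r1 <= l x u r2 + c5 * ref_dist r1 r2 ^+ 2 + c6 * ref_dist r1 r2.

Variables (cb cf : R) (kf : 'rV[R]_n -> 'rV[R]_n * 'rV[R]_m -> 'rV[R]_m).
Hypotheses (cb_gt0 : 0 < cb) (cf_gt0 : 0 < cf).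
Hypothesis Xf_ball : forall r, Ref r -> eucl_cball cb r.1 `<=` Xf r.
Hypothesis Xf_inv : forall r x, Ref r -> Xf r x -> Xf r (f (x, kf x r)).
Hypothesis Vf_decr : forall r x, Ref r -> Xf r x ->
  Vf (f (x, kf x r)) r - Vf x r <= - l x (kf x r) r.
Hypothesis kf_Z : forall r x, Ref r -> Xf r x -> Z (x, kf x r).
Hypothesis Vf_upper : forall r x, Ref r -> Xf r x -> Vf x r <= cf * lbar x r.

(* The two smallness conditions on [q] are met by taking the step length theta
   of (vii) small: there [q] is of order theta^2 and [p] of order theta. *)
Variables p q : R.
Hypotheses (p_gt0 : 0 < p) (q_gt0 : 0 < q).
Hypothesis ref_improve : forall r, Ref r -> exists rhat,
  [/\ Ref rhat, ref_dist rhat r ^+ 2 <= q * ref_dist r rd ^+ 2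
    & T rhat <= T r - p * ref_dist r rd ^+ 2].
Hypothesis q_ball : forall r, Ref r -> 4 * q * ref_dist r rd ^+ 2 <= cb ^+ 2.
Hypothesis q_cost : 4 * (cf * c2 * q) <= p.

(** * Terminal law and steering to [rd] *)

Local Notation run r k y := (closed_loop f (kf^~ r) k y).

Lemma stage_lower x u r : Z (x, u) -> Ref r ->
  c1 * eucl_dist x r.1 ^+ 2 <= l x u r.
Proof.
move=> Zxu rr; have /andP[+ _] := lbar_quad Zxu rr.
by move=> /le_trans; apply; exact: lbar_le.
Qed.

Lemma terminal_cost_upper x r : Ref r -> Xf r x ->
  Vf x r <= cf * c2 * eucl_dist x r.1 ^+ 2.
Proof.
move=> rr xr; apply: le_trans (Vf_upper rr xr) _; rewrite -mulrA ler_pM2l //.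
by have /andP[] := lbar_quad (kf_Z rr xr) rr.
Qed.

Lemma terminal_ball x r : Ref r -> eucl_dist x r.1 ^+ 2 <= cb ^+ 2 -> Xf r x.
Proof.
move=> rr xr; apply: (Xf_ball rr); rewrite /eucl_cball/=.
by rewrite -(@ler_pXn2r _ 2) // nnegrE ?eucl_dist_ge0 ?ltW.
Qed.

Lemma terminal_run r y k : Ref r -> Xf r y ->
  Xf r (run r k y) /\
  \sum_(0 <= j < k) l (run r j y) (kf (run r j y) r) r
    + Vf (run r k y) r <= Vf y r.
Proof.
move=> rr yr; elim: k => [|k [xk IH]]; first by rewrite big_geq // add0r.
rewrite big_nat_recr //=; split; first exact: Xf_inv.
by have := Vf_decr rr xk; lra.
Qed.

(** The stage costs along the terminal run sum to at most [Vf y r], so one of them is at most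
    [c1 * e], and stage costs dominate the squared distance. *)
Lemma terminal_run_close r y (e : R) : Ref r -> Xf r y -> 0 < e ->
  exists k, eucl_dist (run r k y) r.1 ^+ 2 <= e.
Proof.
move=> rr yr e0; pose z k := run r k y.
have [K hK] := exists_natr_gt (Vf y r) (mulr_gt0 c1_gt0 e0).
pose a k := l (z k) (kf (z k) r) r.
have [|k _ hk] := @exists_small_term _ a (Vf y r) (c1 * e) K _ hK.
  have [xK] := terminal_run K rr yr; apply: le_trans.
  by rewrite lerDl Vf_ge0 //; apply: Xf_sub xK.
exists k; rewrite -(ler_pM2l c1_gt0); apply: le_trans hk; apply: stage_lower => //.
by apply: kf_Z => //; have [] := terminal_run k rr yr.
Qed.

(* Some admissible infinite input drives [y] to [rd] at infinite-horizon cost at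
   most [c]; bounding the partial sums keeps the cost in [R]. *)
Definition steers y c := exists u,
  [/\ forall k, Z (traj f u y k, u k),
      forall e : R, 0 < e -> exists M, forall k, (M <= k)%N ->
        eucl_dist (traj f u y k) rd.1 ^+ 2 <= e
    & forall K, \sum_(0 <= k < K) l (traj f u y k) (u k) rd <= c].

(** One visit close to [rd] gives convergence: from then on every stage cost, hence [c1] times every
    squared distance, is at most the terminal cost at that visit. *)
Lemma steers_terminal y : Xf rd y -> steers y (Vf y rd).
Proof.
move=> yrd; pose z k := run rd k y.
have trajE k : traj f (fun j => kf (z j) rd) y k = z k.
  exact: (traj_closed_loop f (kf^~ rd)).
exists (fun k => kf (z k) rd); split.
- by move=> k; rewrite trajE; apply: kf_Z => //; have [] := terminal_run k rd_ref yrd.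
- move=> e e0; have cc : 0 < cf * c2 by rewrite mulr_gt0.
  (* Within this squared radius the terminal cost is at most [c1 * e]. *)
  have [M hM] := terminal_run_close rd_ref yrd (divr_gt0 (mulr_gt0 c1_gt0 e0) cc).
  exists M => k Mk; rewrite trajE /z -(subnK Mk).
  have [xM _] := terminal_run M rd_ref yrd.
  rewrite {1}/closed_loop iterD -/(closed_loop _ _ _ _) -/(closed_loop _ _ _ _).
  set w := closed_loop _ _ M y in hM xM *.
  have [xk' _] := terminal_run (k - M) rd_ref xM.
  have [xk +] := terminal_run (k - M).+1 rd_ref xM; rewrite big_nat_recr //= => tail.
  have Vk := Vf_ge0 (Xf_sub rd_ref xk) rd_ref; rewrite /= in Vk.
  have lk := stage_lower (kf_Z rd_ref xk') rd_ref.
  have VM := terminal_cost_upper rd_ref xM.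
  have : 0 <= \sum_(0 <= j < k - M) l (run rd j w) (kf (run rd j w) rd) rd.
    apply: sumr_ge0 => j _; apply: l_ge0 => //; apply: kf_Z => //.
    by have [] := terminal_run j rd_ref xM.
  move=> sum_ge0; rewrite ler_pdivlMr // in hM.
  by rewrite -(ler_pM2l c1_gt0); lra.
- move=> K; have [xK] := terminal_run K rd_ref yrd; apply: le_trans.
  under eq_bigr do rewrite trajE.
  by rewrite lerDl Vf_ge0 //; apply: Xf_sub xK.
Qed.

Lemma steers_cons y v c : Z (y, v) -> steers (f (y, v)) c -> steers y (c + l y v rd).
Proof.
move=> Zyv [u [uZ u_cvg u_sum]].
exists (fun j => if j is i.+1 then u i else v); split.
- by case=> [|k] //; rewrite traj_cons.
- move=> e /u_cvg[M hM]; exists M.+1; case=> // k; rewrite ltnS traj_cons; exact: hM.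
- case=> [|K].
    rewrite big_geq //; apply: addr_ge0; last exact: l_ge0.
    by have := u_sum 0%N; rewrite big_geq.
  rewrite big_nat_recl //= addrC lerD2r.
  by under eq_bigr => k _ do rewrite -/(traj f _ y k.+1) traj_cons.
Qed.

Lemma steers_prefix u y K c : (forall k, (k < K)%N -> Z (traj f u y k, u k)) ->
  steers (traj f u y K) c ->
  steers y (c + \sum_(0 <= k < K) l (traj f u y k) (u k) rd).
Proof.
elim: K c => [|K IH] c uZ yK; first by rewrite big_geq // addr0.
rewrite big_nat_recr //= [X in c + X]addrC addrA; apply: IH => [k kK|].
  by apply: uZ; rewrite ltnS ltnW.
by apply: steers_cons => //; apply: uZ.
Qed.

Lemma steers_closed_loop mu y K c :
  (forall k, (k < K)%N -> Z (closed_loop f mu k y, mu (closed_loop f mu k y))) ->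
  steers (closed_loop f mu K y) c -> steers y (c + Jd_cl f l rd mu K y).
Proof.
move=> muZ yK; pose u j := mu (closed_loop f mu j y).
have trajE k : traj f u y k = closed_loop f mu k y := traj_closed_loop f mu y k.
have := @steers_prefix u y K c; rewrite trajE /Jd_cl.
under eq_bigr do rewrite trajE.
by apply => // k kK; rewrite trajE; apply: muZ.
Qed.

(** Run the terminal law until the state is within [cb / 2] of [r]. It then lies in the terminal set
    of any reference within [cb / 2] of [r]. Either [rd] is such a reference, or [r] is so far from
    [rd] that the improved reference gains a fixed amount of offset cost. *)
Lemma terminal_set_improve r y : Ref r -> Xf r y -> exists k s,
  [/\ Ref s, Xf s (run r k y)
    & s = rd \/ T s <= T r - p * (cb ^+ 2 / 4)].
Proof.
move=> rr yr; have cb4 : 0 < cb ^+ 2 / 4 by rewrite divr_gt0 // exprn_gt0.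
have [k hk] := terminal_run_close rr yr cb4; exists k.
have near_r s : Ref s -> ref_dist s r ^+ 2 <= cb ^+ 2 / 4 ->
    Xf s (run r k y).
  move=> rs sr; apply: terminal_ball => //.
  have := eucl_dist_sqr_triangle r.1 (run r k y) s.1.
  by have := eucl_dist1_le s r; rewrite [eucl_dist r.1 _ ^+ 2]eucl_dist_sqrC; lra.
have [rd_near|rd_far] := leP (ref_dist r rd ^+ 2) (cb ^+ 2 / 4).
  exists rd; split=> //; [apply: near_r => //|by left].
  by rewrite ref_distC.
have [s [rs sr Ts]] := ref_improve rr.
exists s; split => //; first by apply: near_r => //; have := q_ball rr; lra.
by right; apply: le_trans Ts _; rewrite lerD2l lerN2 ler_pM2l // ltW.
Qed.

(** Each change of reference that does not reach [rd] lowers [T] by at least [eta], and [T] is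
    nonnegative on references; the induction is on a bound for the number of changes. *)
Lemma steers_from_terminal_set r y : Ref r -> Xf r y -> exists c, steers y c.
Proof.
pose eta := p * (cb ^+ 2 / 4).
have eta0 : 0 < eta by rewrite mulr_gt0 // divr_gt0 // exprn_gt0.
move=> rr yr; have [J hJ] := exists_natr_gt (T r) eta0.
elim: J r y rr yr hJ => [|J IH] r y rr yr hJ.
  by have := T_ge0 rr; rewrite mul0r in hJ; lra.
have [k [s [rs ys sT]]] := terminal_set_improve rr yr.
have [c yc] : exists c, steers (run r k y) c.
  case: sT => [sd|sT].
    by rewrite sd in ys; exists (Vf (run r k y) rd); exact: steers_terminal.
  by apply: (IH s) => //; move: hJ sT; rewrite -natr1 mulrDl mul1r -/eta; lra.
exists (c + Jd_cl f l rd (kf^~ r) k y); apply: steers_closed_loop yc => j _.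
by apply: kf_Z => //; have [] := terminal_run j rr yr.
Qed.

(** * The value function and its decrease along the closed loop *)

Variables (lam : nat -> R).
Hypothesis lam_ge : forall N : nat, N%:R <= lam N.
Variable sol : nat -> 'rV[R]_n -> (nat -> 'rV[R]_m) * ('rV[R]_n * 'rV[R]_m).
Local Notation feasible := (mpc_feasible f X U Z Zr Xf).
Hypothesis sol_opt : forall N x, (0 < N)%N -> feasible N x ->
  mpc_optimal f X U Z Zr l Vf Xf T lam N x (sol N x).

Local Notation V N y := (mpc_cost f l Vf T lam N y (sol N y)).
Local Notation mu := (mpc_law sol).
Local Notation stage N y := (l y (mu N y) (sol N y).2).

Lemma value_le N y u r : (0 < N)%N -> X y -> Ref r ->
  (forall k, (k < N)%N -> Z (traj f u y k, u k)) -> Xf r (traj f u y N) ->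
  feasible N y /\ V N y <= Jtc f l Vf N y u r + lam N * T r.
Proof.
move=> N0 Xy rr uZ yN.
have cand : mpc_candidates f X U Z Zr Xf N y (u, r).
  split=> //; split=> //=; last exact: Xf_sub yN.
  by move=> k /uZ /Z_sub[].
have feas : feasible N y by split=> //; exists (u, r).
by split=> //; have [_ /(_ _ cand)] := sol_opt N0 feas.
Qed.

Lemma sol_admissible N y : (0 < N)%N -> feasible N y ->
  [/\ Ref (sol N y).2,
      forall k, (k < N)%N -> Z (traj f (sol N y).1 y k, (sol N y).1 k)
    & Xf (sol N y).2 (traj f (sol N y).1 y N)].
Proof. by move=> N0 /(sol_opt N0)[[rr [_ uZ _ yN]] _]. Qed.

Lemma sol_ref N y : (0 < N)%N -> feasible N y -> Ref (sol N y).2.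
Proof. by move=> N0 /(sol_admissible N0)[]. Qed.

Lemma law_admissible N y : (0 < N)%N -> feasible N y -> Z (y, mu N y).
Proof. by move=> N0 /(sol_admissible N0)[_ /(_ 0%N N0)]. Qed.

Lemma value_lower N y : (0 < N)%N -> feasible N y ->
  stage N y + lam N * T (sol N y).2 <= V N y.
Proof.
move=> N0 fy; have [rr uZ yN] := sol_admissible N0 fy.
rewrite lerD2r /Jtc; case: N N0 fy rr uZ yN => // N N0 fy rr uZ yN.
rewrite big_nat_recl //= -addrA lerDl addr_ge0 ?Vf_ge0 //; last exact: Xf_sub yN.
rewrite big_seq; apply: sumr_ge0 => k; rewrite mem_index_iota => /andP[_ kN].
by apply: l_ge0 => //; apply: (uZ k.+1).
Qed.

Let lam_ge0 N : 0 <= lam N.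
Proof. exact: le_trans (lam_ge N). Qed.

Lemma stage_ge0 N y : (0 < N)%N -> feasible N y -> 0 <= stage N y.
Proof. by move=> N0 fy; apply: l_ge0 (law_admissible N0 fy) (sol_ref N0 fy). Qed.

Lemma stage_le_value N y : (0 < N)%N -> feasible N y -> stage N y <= V N y.
Proof.
move=> N0 fy; apply: le_trans (value_lower N0 fy).
by rewrite lerDl mulr_ge0 ?lam_ge0 ?T_ge0 //; exact: sol_ref.
Qed.

Lemma offset_le_value N y : (0 < N)%N -> feasible N y ->
  lam N * T (sol N y).2 <= V N y.
Proof.
by move=> N0 fy; apply: le_trans (value_lower N0 fy); rewrite lerDr stage_ge0.
Qed.

(* The candidate at the successor state: shift the optimal inputs, append the
   terminal law. *)
Lemma value_decrease N y : (0 < N)%N -> feasible N y ->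
  feasible N (f (y, mu N y)) /\ V N (f (y, mu N y)) + stage N y <= V N y.
Proof.
case: N => // N N0 fy; have [rr uZ yN] := sol_admissible N0 fy.
set u := (sol N.+1 y).1 in uZ yN; set r := (sol N.+1 y).2 in rr yN.
pose v := kf (traj f u y N.+1) r.
pose u' k := if (k < N)%N then u k.+1 else v.
have trajE k : (k <= N)%N -> traj f u' (f (y, u 0%N)) k = traj f u y k.+1.
  move=> kN; rewrite -(traj_cons f (u 0%N) u' y k).
  apply: traj_ext => -[//|j]; rewrite ltnS => jk.
  by rewrite /u' (leq_trans jk kN).
have muE : mu N.+1 y = u 0%N by [].
have [//||//||| fy' le_V] := @value_le N.+1 (f (y, u 0%N)) u' r.
(* The successor lies in [X] by the constraint at time 1, or, when the horizon is one, because it is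
   the terminal state. *)
- case: (ltnP 0 N) => [N1|]; first by have /Z_sub[] := uZ 1%N N1.
  by rewrite leqn0 => /eqP E; apply: Xf_sub rr _ _; move: yN; rewrite E.
- move=> k; rewrite ltnS => kN; rewrite trajE // /u'.
  case: ltnP => [kN'|Nk]; first exact: uZ.
  have -> : k = N by apply/eqP; rewrite eqn_leq kN.
  exact: kf_Z.
- rewrite /= trajE // /u' ltnn; exact: Xf_inv.
rewrite muE; split=> //.
have -> : V N.+1 y = Jtc f l Vf N.+1 y u r + lam N.+1 * T r by [].
apply: le_trans (lerD le_V (lexx _)) _; rewrite [_ + l _ _ _]addrAC lerD2r /Jtc.
rewrite big_nat_recr //= trajE // /u' ltnn big_nat_recl //= -/v.
rewrite (eq_big_nat _ _ (F2 := fun k => l (traj f u y k.+1) (u k.+1) r)); last first.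
  by move=> k /andP[_ kN]; rewrite trajE ?kN // ltnW.
have := Vf_decr rr yN; rewrite /= -/v; lra.
Qed.

(** The candidate is the terminal run itself, whose cost telescopes to at most [Vf y r] whatever the
    horizon. *)
Lemma value_terminal N y r : (0 < N)%N -> Ref r -> Xf r y ->
  feasible N y /\ V N y <= cf * c2 * eucl_dist y r.1 ^+ 2 + lam N * T r.
Proof.
move=> N0 rr yr; pose u j := kf (run r j y) r.
have trajE k : traj f u y k = run r k y := traj_closed_loop f (kf^~ r) y k.
have [yN sumN] := terminal_run N rr yr.
have [//||//||| fy le_V] := @value_le N y u r; first exact: Xf_sub yr.
- move=> k _; rewrite trajE; apply: kf_Z => //.
  by have [] := terminal_run k rr yr.
- by rewrite trajE.
split=> //; apply: le_trans le_V _; rewrite lerD2r /Jtc trajE.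
under eq_bigr do rewrite trajE.
exact: le_trans sumN (terminal_cost_upper rr yr).
Qed.

(* If the state were much closer to the optimal reference than that reference is
   to [rd], the improved reference of (vii) would have a smaller total cost. *)
Lemma sol_ref_close N y : (0 < N)%N -> feasible N y ->
  c1 * q * ref_dist (sol N y).2 rd ^+ 2 <= stage N y.
Proof.
move=> N0 fy; have rr := sol_ref N0 fy; set r := (sol N y).2 in rr *.
have Zy := law_admissible N0 fy.
apply: le_trans (stage_lower Zy rr); rewrite -mulrA ler_pM2l // leNgt.
apply/negP => lt_q; have [s [rs sr Ts]] := ref_improve rr.
have tri := eucl_dist_sqr_triangle r.1 y s.1.
have := eucl_dist1_le s r; rewrite eucl_dist_sqrC => /le_trans/(_ sr) rs1.
have ys_lt : eucl_dist y s.1 ^+ 2 < 4 * q * ref_dist r rd ^+ 2 by lra.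
have ys : Xf s y by apply: terminal_ball => //; apply: le_trans (ltW ys_lt) (q_ball rr).
have [_] := value_terminal N0 rs ys.
have := offset_le_value N0 fy; rewrite -/r.
(* Moving from [r] to [s] saves at least [lam N * p] times the squared distance of [r] to [rd]. As
   [lam N] is at least 1, this exceeds the whole terminal cost at [s], contradicting optimality. *)
have lam1 : 1 <= lam N by apply: le_trans (lam_ge N); rewrite ler1n.
have cc : 0 < cf * c2 by rewrite mulr_gt0.
have : cf * c2 * eucl_dist y s.1 ^+ 2 < p * ref_dist r rd ^+ 2.
  have : cf * c2 * eucl_dist y s.1 ^+ 2 < cf * c2 * (4 * q * ref_dist r rd ^+ 2).
    by rewrite ltr_pM2l.
  by have := ler_wpM2r (sqr_ge0 (ref_dist r rd)) q_cost; lra.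
have : 0 <= (lam N - 1) * (p * ref_dist r rd ^+ 2).
  by rewrite mulr_ge0 ?subr_ge0 // mulr_ge0 ?sqr_ge0 // ltW.
have := ler_wpM2l (lam_ge0 N) Ts; nra.
Qed.

Lemma stage_rd_le N y : (0 < N)%N -> feasible N y ->
  l y (mu N y) rd <= (c3 + c4 / (c1 * q)) * stage N y.
Proof.
move=> N0 fy; have rr := sol_ref N0 fy; have Zy := law_admissible N0 fy.
apply: le_trans (l_quad rd_ref rr Zy) _.
rewrite mulrDl lerD2l -[c4 / _ * _]mulrA ler_pM2l // mulrC ler_pdivlMr ?mulr_gt0 //.
by apply: le_trans (sol_ref_close N0 fy); rewrite mulrC ref_distC.
Qed.

Lemma closed_loop_value N y K : (0 < N)%N -> feasible N y ->
  feasible N (closed_loop f (mu N) K y) /\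
  \sum_(0 <= k < K) stage N (closed_loop f (mu N) k y) + V N (closed_loop f (mu N) K y)
    <= V N y.
Proof.
move=> N0 fy; elim: K => [|K [fK IH]]; first by rewrite big_geq // add0r.
have [fK' decK] := value_decrease N0 fK.
rewrite big_nat_recr //=; split=> //; lra.
Qed.

Lemma closed_loop_feasible N y K : (0 < N)%N -> feasible N y ->
  feasible N (closed_loop f (mu N) K y).
Proof. by move=> N0 fy; have [] := closed_loop_value K N0 fy. Qed.

Lemma closed_loopD g i j y :
  closed_loop f g (i + j) y = closed_loop f g i (closed_loop f g j y).
Proof. exact: iterD. Qed.

Lemma value_ge0 N y : (0 < N)%N -> feasible N y -> 0 <= V N y.
Proof. by move=> N0 fy; apply: le_trans (stage_ge0 N0 fy) (stage_le_value N0 fy). Qed.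

Lemma value_nonincreasing N y i j : (0 < N)%N -> feasible N y -> (i <= j)%N ->
  V N (closed_loop f (mu N) j y) <= V N (closed_loop f (mu N) i y).
Proof.
move=> N0 fy ij; rewrite -(subnK ij) closed_loopD.
have fi := closed_loop_feasible i N0 fy.
have [_] := closed_loop_value (j - i) N0 fi; apply: le_trans; rewrite lerDr.
by apply: sumr_ge0 => k _; apply: stage_ge0 => //; apply: closed_loop_feasible.
Qed.

(** * Bounds uniform in the horizon *)

Let kap := c3 + c4 / (c1 * q).

Let kap_gt0 : 0 < kap.
Proof. by rewrite addr_gt0 // divr_gt0 // mulr_gt0. Qed.

Lemma state_close_of_stage N y : (0 < N)%N -> feasible N y ->
  c1 * eucl_dist y rd.1 ^+ 2 <= kap * stage N y.
Proof.
move=> N0 fy; apply: le_trans (stage_lower (law_admissible N0 fy) rd_ref) _.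
exact: stage_rd_le.
Qed.

(** Cut the steering input at time [N], once it has entered the ball around [rd] where the terminal
    cost is at most [e]. With reference [rd] the offset term vanishes. *)
Lemma steers_value x c (e : R) : steers x c -> 0 < e ->
  exists M, forall N, (0 < N)%N -> (M <= N)%N -> feasible N x /\ V N x <= c + e.
Proof.
move=> [u [uZ u_cvg u_sum]] e0; have cc : 0 < cf * c2 by rewrite mulr_gt0.
have [|M hM] := u_cvg (Num.min (cb ^+ 2) (e / (cf * c2))).
  by rewrite lt_min exprn_gt0 // divr_gt0.
exists M => N N0 /hM; rewrite le_min ler_pdivlMr // => /andP[in_ball uN].
have xN := terminal_ball rd_ref in_ball.
have Xx : X x by have /Z_sub[] := uZ 0%N.
have [//|fx le_V] := value_le N0 Xx rd_ref _ xN.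
split=> //; apply: le_trans le_V _; rewrite T_rd mulr0 addr0 lerD //.
by apply: le_trans (terminal_cost_upper rd_ref xN) _; rewrite mulrC.
Qed.

(* Uniform in the horizon: since the stage costs sum to at most [C], the closed
   loop enters a prescribed neighbourhood of [rd] within a number of steps that
   does not depend on [N], and the value function never increases. *)
Lemma uniform_convergence (C d : R) : 0 < d -> exists K0, forall N y K,
  (0 < N)%N -> feasible N y -> V N y <= C -> (K0 <= K)%N ->
  V N (closed_loop f (mu N) K y) <= d.
Proof.
move=> d0; have cc : 0 < cf * c2 by rewrite mulr_gt0.
pose d' := Num.min (cb ^+ 2) (d / (cf * c2)).
have d'0 : 0 < d' by rewrite lt_min exprn_gt0 // divr_gt0.
(* A stage cost below this threshold forces squared distance at most [d'] to [rd]; there the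
   terminal-law candidate is available and costs at most [d]. *)
have e0 : 0 < c1 * d' / kap by rewrite divr_gt0 // mulr_gt0.
have [K0 hK0] := exists_natr_gt C e0.
exists K0 => N y K N0 fy VC K0K.
have [_ sumK0] := closed_loop_value K0 N0 fy.
have VK0 := value_ge0 N0 (closed_loop_feasible K0 N0 fy).
pose a k := stage N (closed_loop f (mu N) k y).
have [|k kK0] := @exists_small_term _ a C _ K0 _ hK0.
  by lra.
rewrite ler_pdivlMr // mulrC => small_k.
have fk := closed_loop_feasible k N0 fy.
have := le_trans (state_close_of_stage N0 fk) small_k.
rewrite ler_pM2l // le_min ler_pdivlMr // => /andP[in_ball close].
have [_] := value_terminal N0 rd_ref (terminal_ball rd_ref in_ball).
rewrite T_rd mulr0 addr0 mulrC => /le_trans/(_ close); apply: le_trans.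
by apply: value_nonincreasing => //; apply: leq_trans K0K; apply: ltnW.
Qed.

(** The offset term is at most [C] while its weight is at least [N]. Strict monotonicity of [alo]
    turns a small [T] into a small distance without inverting [alo]. *)
Lemma sol_ref_cvg (C d : R) : 0 < d -> exists M, forall N y,
  (0 < N)%N -> (M <= N)%N -> feasible N y -> V N y <= C ->
  ref_dist (sol N y).2 rd <= d.
Proof.
move=> d0; have alo_d : 0 < alo d by rewrite -alo0 alo_incr.
have [M hM] := exists_natr_gt C alo_d.
exists M => N y N0 MN fy VC; rewrite leNgt; apply/negP => d_lt.
have rr := sol_ref N0 fy.
have T_big : alo d <= T (sol N y).2.
  by apply: le_trans (T_lower rr); apply: ltW; apply: alo_incr => //; apply: ltW.
have : M%:R * alo d <= lam N * T (sol N y).2.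
  apply: ler_pM => //; first exact: ltW.
  by apply: le_trans (lam_ge N); rewrite ler_nat.
have := offset_le_value N0 fy; lra.
Qed.

(** * Closed-loop performance and its limit *)

Lemma Jd_clD g i j y :
  Jd_cl f l rd g (i + j) y = Jd_cl f l rd g i y + Jd_cl f l rd g j (closed_loop f g i y).
Proof.
rewrite /Jd_cl (big_cat_nat _ (n := i)) ?leq_addr //=; congr (_ + _).
rewrite -{1}[i]add0n big_addn addKn; apply: eq_bigr => k _.
by rewrite closed_loopD.
Qed.

(** Meant for the tail: the factor [kap] is harmless where the value function is already small, and
    the bound does not grow with [K]. *)
Lemma Jd_cl_le_value N y K : (0 < N)%N -> feasible N y ->
  Jd_cl f l rd (mu N) K y <= kap * V N y.
Proof.
move=> N0 fy; have [fK sumK] := closed_loop_value K N0 fy.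
have VK := value_ge0 N0 fK.
apply: (@le_trans _ _ (kap * \sum_(0 <= k < K) stage N (closed_loop f (mu N) k y))).
  rewrite mulr_sumr ler_sum // => k _; apply: stage_rd_le => //.
  exact: closed_loop_feasible.
rewrite ler_pM2l //; lra.
Qed.

(** Meant for the initial steps: the value enters with coefficient 1, at the price of an error
    proportional to [K]. Since [d <= 1], the quadratic error of [l_lin] is absorbed into the linear
    one. *)
Lemma Jd_cl_le_sol_ref N y K (d : R) : (0 < N)%N -> feasible N y -> 0 <= d <= 1 ->
  (forall k, (k < K)%N -> ref_dist (sol N (closed_loop f (mu N) k y)).2 rd <= d) ->
  Jd_cl f l rd (mu N) K y <= V N y + K%:R * ((c5 + c6) * d).
Proof.
move=> N0 fy /andP[d0 d1] close; have [fK sumK] := closed_loop_value K N0 fy.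
have VK := value_ge0 N0 fK.
suff : Jd_cl f l rd (mu N) K y <=
    \sum_(0 <= k < K) stage N (closed_loop f (mu N) k y) + K%:R * ((c5 + c6) * d) by lra.
rewrite -[K in K%:R]subn0 mulr_natl -sumr_const_nat -big_split /Jd_cl.
apply: ler_sum_nat => k /andP[_ kK].
have fk := closed_loop_feasible k N0 fy.
have := l_lin rd_ref (sol_ref N0 fk) (law_admissible N0 fk).
rewrite (ref_distC rd); have := close k kK.
have := ref_dist_ge0 (sol N (closed_loop f (mu N) k y)).2 rd.
move: (ref_dist _ _) => t t0 td le_l.
have : c5 * t ^+ 2 <= c5 * d by rewrite ler_pM2l // expr2; nra.
have : c6 * t <= c6 * d by rewrite ler_pM2l.
rewrite /= in le_l *; lra.
Qed.

(** Each third of [e] pays for one error: the excess of the value over [c], the reference mismatch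
    during the first [K0] steps, and the tail after them. *)
Lemma closed_loop_cost_upper x c (e : R) : steers x c -> 0 < e ->
  exists M, forall N K, (M <= N)%N -> (M <= K)%N ->
    Jd_cl f l rd (mu N) K x <= c + e.
Proof.
move=> xc e0; have e3 : 0 < e / 3 by rewrite divr_gt0.
have [N1 hN1] := steers_value xc e3.
have [K0 hK0] := uniform_convergence (c + e / 3) (divr_gt0 e3 kap_gt0).
(* The added 1 keeps [w] positive, so that one may divide by it even when [K0 = 0]. *)
pose w := (K0%:R + 1) * (c5 + c6).
have w0 : 0 < w by rewrite mulr_gt0 ?natr1 ?ltr0Sn ?addr_gt0.
pose d := Num.min 1 (e / 3 / w).
have d0 : 0 < d by rewrite lt_min ltr01 divr_gt0.
have [N2 hN2] := sol_ref_cvg (c + e / 3) d0.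
exists (maxn 1 (maxn N1 (maxn N2 K0))) => N K.
rewrite !geq_max => /and4P[N0 N1N N2N _] /and4P[_ _ _ K0K].
have [fx Vx] := hN1 N N0 N1N.
rewrite -(subnKC K0K) Jd_clD.
have fK := closed_loop_feasible K0 N0 fx.
have tail := Jd_cl_le_value (K - K0) N0 fK.
have VK0 := hK0 N x K0 N0 fx Vx (leqnn _); rewrite ler_pdivlMr // in VK0.
have head : Jd_cl f l rd (mu N) K0 x <= V N x + K0%:R * ((c5 + c6) * d).
  apply: Jd_cl_le_sol_ref => // [|k kK0]; first by rewrite ltW //= ge_min lexx.
  apply: hN2 => //; first exact: closed_loop_feasible.
  by apply: le_trans Vx; apply: (@value_nonincreasing N x 0 k).
have : w * d <= e / 3.
  by rewrite mulrC -ler_pdivlMr // ge_min lexx orbT.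
have -> : w * d = K0%:R * ((c5 + c6) * d) + (c5 + c6) * d by rewrite /w; ring.
have : 0 <= (c5 + c6) * d by rewrite mulr_ge0 ?ltW // addr_gt0.
lra.
Qed.

(* Finitely many closed-loop steps followed by the terminal law steer [x] to
   [rd], so their cost competes in the infimum. *)
Lemma closed_loop_cost_lower x c (e : R) : steers x c -> 0 < e ->
  exists M, forall N K, (M <= N)%N -> (M <= K)%N ->
    steers x (Jd_cl f l rd (mu N) K x + e).
Proof.
move=> xc e0; have cc : 0 < cf * c2 by rewrite mulr_gt0.
have [N1 hN1] := steers_value xc ltr01.
pose d := Num.min (cb ^+ 2) (e / (cf * c2)).
have d0 : 0 < d by rewrite lt_min exprn_gt0 // divr_gt0.
have [K0 hK0] := uniform_convergence (c + 1) (divr_gt0 (mulr_gt0 c1_gt0 d0) kap_gt0).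
exists (maxn 1 (maxn N1 K0)) => N K.
rewrite !geq_max => /and3P[N0 N1N _] /and3P[_ _ K0K].
have [fx Vx] := hN1 N N0 N1N; have fK := closed_loop_feasible K N0 fx.
have VK := hK0 N x K N0 fx Vx K0K; rewrite ler_pdivlMr // in VK.
have := state_close_of_stage N0 fK.
have le_V : kap * stage N (closed_loop f (mu N) K x) <= c1 * d.
  by apply: le_trans VK; rewrite mulrC ler_pM2r //; exact: stage_le_value.
move=> /le_trans/(_ le_V); rewrite ler_pM2l // le_min ler_pdivlMr //.
move=> /andP[in_ball close]; have xK := terminal_ball rd_ref in_ball.
have muZ k : (k < K)%N -> Z (closed_loop f (mu N) k x, mu N (closed_loop f (mu N) k x)).
  by move=> _; apply: law_admissible => //; apply: closed_loop_feasible.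
have [u [uZ u_cvg u_sum]] := steers_closed_loop muZ (steers_terminal xK).
exists u; split=> // j; apply: le_trans (u_sum j) _; rewrite addrC lerD2l.
by apply: le_trans (terminal_cost_upper rd_ref xK) _; rewrite mulrC.
Qed.

Lemma steers_ge0 x c : steers x c -> 0 <= c.
Proof. by move=> [u [_ _ /(_ 0%N)]]; rewrite big_geq. Qed.

(** The upper estimate needs a nearly optimal cost [b]. The lower one works with any finite [c],
    which only serves to bound the values uniformly. *)
Lemma closed_loop_cost_cvg x c (e : R) : steers x c -> 0 < e ->
  exists M, forall N K, (M <= N)%N -> (M <= K)%N ->
    `|inf [set c | steers x c] - Jd_cl f l rd (mu N) K x| <= e.
Proof.
move=> xc e0; set S := [set c | _].
have S_inf : has_inf S by split; [exists c | exists 0 => b /steers_ge0].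
have e2 : 0 < e / 2 by rewrite divr_gt0.
have [b xb b_lt] := inf_adherent e2 S_inf.
have [M1 up] := closed_loop_cost_upper xb e2.
have [M2 low] := closed_loop_cost_lower xc e0.
exists (maxn M1 M2) => N K; rewrite !geq_max => /andP[? ?] /andP[? ?].
have le_up : Jd_cl f l rd (mu N) K x <= b + e / 2 by exact: up.
have le_low : inf S <= Jd_cl f l rd (mu N) K x + e.
  by apply: ge_inf; [exact: S_inf.2 | exact: low].
rewrite ler_norml; apply/andP; split; lra.
Qed.

Lemma feasible_steers N x : feasible N x -> exists c, steers x c.
Proof.
move=> [_ [[u r] [/= rr [_ uZ _ xN]]]].
have [c yc] := steers_from_terminal_set rr xN.
by exists (c + \sum_(0 <= k < N) l (traj f u x k) (u k) rd); apply: steers_prefix.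
Qed.

Lemma steers_le_Jd_inf x u : inputs_to_inf f U Z [set rd.1] x u ->
  ((inf [set c | steers x c])%:E <= Jd_inf f l rd x u)%E.
Proof.
move=> [_ uZ u_cvg].
have l0 k : (0 <= (l (traj f u x k) (u k) rd)%:E)%E by rewrite lee_fin l_ge0.
have sum_le K : ((\sum_(0 <= k < K) l (traj f u x k) (u k) rd)%:E <= Jd_inf f l rd x u)%E.
  by rewrite -sumEFin; apply: nneseries_lim_ge => k _ _; exact: l0.
(* An infinite cost is trivially large, and the empty partial sum excludes [-oo]. *)
case: (Jd_inf f l rd x u) sum_le => [c| |] sum_le; last 2 first.
- exact: leey.
- by have := sum_le 0%N.
rewrite lee_fin; apply: ge_inf; first by exists 0 => b /steers_ge0.
exists u; split=> // e e0.
have se : 0 < Num.sqrt e by rewrite sqrtr_gt0.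
have /cvgrPdist_le/(_ _ se)[M _ hM] := u_cvg.
exists M => k /hM /=; rewrite /eucl_dist_set image_set1 inf1 sub0r normrN.
rewrite ger0_norm ?eucl_dist_ge0 // => le_e.
by rewrite -[leRHS](sqr_sqrtr (ltW e0)) ler_pXn2r ?nnegrE ?eucl_dist_ge0 ?sqrtr_ge0.
Qed.

Lemma closed_loop_cost_limit Nt x : feasible Nt x -> exists2 L : \bar R,
    (fun NK : nat * nat => (Jd_cl f l rd (mu NK.1) NK.2 x)%:E) @ (\oo, \oo) --> L
  & (L <= ereal_inf [set Jd_inf f l rd x u
                    | u in inputs_to_inf f U Z [set rd.1] x])%E.
Proof.
move=> /feasible_steers[c xc].
exists (inf [set c | steers x c])%:E; last first.
  by apply: le_ereal_inf_tmp => _ [u xu <-]; apply: steers_le_Jd_inf.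
apply: cvg_EFin; first exact: nearW.
apply/cvgrPdist_le => e e0; have [M hM] := closed_loop_cost_cvg xc e0.
exists ([set N | (M <= N)%N], [set K | (M <= K)%N]); first by split; exists M.
by move=> [N K] /= [MN MK]; apply: hM.
Qed.

End Tracking.

(** * Choice of the step length and assembly *)

Theorem theorem3 (R : realType) (n m : nat)
  (* system and constraints *)
  (f : 'rV[R]_n * 'rV[R]_m -> 'rV[R]_n)
  (X : set 'rV[R]_n) (U : set 'rV[R]_m) (Z : set ('rV[R]_n * 'rV[R]_m))
  (f_cont : continuous f)
  (X_bounded : bounded_set X)
  (U_compact : compact U)
  (Z_sub : Z `<=` X `*` U)
  (Z_compact : compact Z)
  (* references and offset cost *)
  (Zr : set ('rV[R]_n * 'rV[R]_m))
  (Zr_closed : closed Zr)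
  (Zr_sub : Zr `<=` Z°)
  (T : 'rV[R]_n * 'rV[R]_m -> R)
  (re rd : 'rV[R]_n * 'rV[R]_m)
  (re_min : forall r, T re <= T r)
  (rd_argmin : unique_argmin T (references f Zr) rd)
  (T_rd : T rd = 0)
  (* costs, terminal sets, scaling function *)
  (l : 'rV[R]_n -> 'rV[R]_m -> 'rV[R]_n * 'rV[R]_m -> R)
  (l_ge0 : forall x u r, X x -> U u -> references f Zr r -> 0 <= l x u r)
  (lbar : 'rV[R]_n -> 'rV[R]_n * 'rV[R]_m -> R)
  (lbar_min : forall x r, X x -> references f Zr r ->
     (exists2 u, U u & Z (x, u)) ->
     is_min [set l x u r | u in [set u | U u /\ Z (x, u)]] (lbar x r))
  (Vf : 'rV[R]_n -> 'rV[R]_n * 'rV[R]_m -> R)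
  (Vf_ge0 : forall x r, X x -> references f Zr r -> 0 <= Vf x r)
  (Xf : 'rV[R]_n * 'rV[R]_m -> set 'rV[R]_n)
  (Xf_sub : forall r, references f Zr r -> Xf r `<=` X)
  (lam : nat -> R)
  (lam_ge0 : forall N, 0 <= lam N)
  (* an optimal solution of the horizon-N problem at each feasible state *)
  (sol : nat -> 'rV[R]_n -> (nat -> 'rV[R]_m) * ('rV[R]_n * 'rV[R]_m))
  (sol_opt : forall N x, (0 < N)%N -> mpc_feasible f X U Z Zr Xf N x ->
     mpc_optimal f X U Z Zr l Vf Xf T lam N x (sol N x))
  (* (i) *)
  (hyp_i : exists alo aup : R -> R,
     [/\ class_Kinf alo, class_Kinf aup
       & forall r, references f Zr r ->
           alo (ref_dist r rd) <= T r <= aup (ref_dist r rd)])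
  (* (ii) *)
  (hyp_ii : exists c1 c2 : R,
     [/\ 0 < c1, 0 < c2
       & forall x u r, Z (x, u) -> references f Zr r ->
           c1 * eucl_dist x r.1 ^+ 2 <= lbar x r <= c2 * eucl_dist x r.1 ^+ 2])
  (* (iii) *)
  (hyp_iii : exists c3 c4 : R,
     [/\ 0 < c3, 0 < c4
       & forall r1 r2 x u,
           references f Zr r1 -> references f Zr r2 -> Z (x, u) ->
           l x u r1 <= c3 * l x u r2 + c4 * ref_dist r1 r2 ^+ 2])
  (* (iv) *)
  (hyp_iv : exists c5 c6 : R,
     [/\ 0 < c5, 0 < c6
       & forall r1 r2 x u,
           references f Zr r1 -> references f Zr r2 -> Z (x, u) ->
           l x u r1 <=
             l x u r2 + c5 * ref_dist r1 r2 ^+ 2 + c6 * ref_dist r1 r2])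
  (* (v) *)
  (Vf_cont : {within X `*` references f Zr,
                continuous (fun p => Vf p.1 p.2)})
  (Xf_compact : forall r, references f Zr r -> compact (Xf r))
  (hyp_v : exists (cb cf : R)
     (kf : 'rV[R]_n -> 'rV[R]_n * 'rV[R]_m -> 'rV[R]_m),
     [/\ 0 < cb, 0 < cf
       & forall r, references f Zr r ->
           eucl_cball cb r.1 `<=` Xf r /\
           forall x, Xf r x ->
             [/\ Xf r (f (x, kf x r)),
                 Vf (f (x, kf x r)) r - Vf x r <= - l x (kf x r) r,
                 Z (x, kf x r)
               & Vf x r <= cf * lbar x r]])
  (* (vi) *)
  (hyp_vi : (forall N : nat, N%:R <= lam N) /\ 1 <= lam 0%N)
  (* (vii) *)
  (hyp_vii : exists c1r c2r : R,
     [/\ 0 < c1r, 0 < c2r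
       & forall r (theta : R), references f Zr r -> 0 <= theta -> theta <= 1 ->
           exists rhat : 'rV[R]_n * 'rV[R]_m,
             [/\ references f Zr rhat,
                 ref_dist rhat r <= c1r * theta * ref_dist r rd
               & T rhat - T r <= - (c2r * theta * ref_dist r rd ^+ 2)]]) :
  forall (Nt : nat) (x : 'rV[R]_n),
    (0 < Nt)%N -> mpc_feasible f X U Z Zr Xf Nt x ->
    exists2 L : \bar R,
      (fun NK : nat * nat =>
         (Jd_cl f l rd (mpc_law sol NK.1) NK.2 x)%:E) @ (\oo, \oo) --> L
      & (L <= ereal_inf [set Jd_inf f l rd x u
                        | u in inputs_to_inf f U Z [set rd.1] x])%E.
Proof.
move=> Nt x Nt0 fx.
have [rd_ref rd_min _] := rd_argmin.
have RefZ r : references f Zr r -> Z r by move=> [/Zr_sub /interior_subset].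
have T_ge0 r : references f Zr r -> 0 <= T r by move=> /rd_min; rewrite T_rd.
have lZ_ge0 y u r : Z (y, u) -> references f Zr r -> 0 <= l y u r.
  by move=> /Z_sub[]; exact: l_ge0.
have lbar_le y u r : Z (y, u) -> references f Zr r -> lbar y r <= l y u r.
  move=> Zyu rr; have [/= Xy Uu] := Z_sub _ Zyu.
  have [|_] := lbar_min y r Xy rr; first by exists u.
  by apply; exists u.
have [alo [aup [[_ alo_incr alo0 _] _ T_bounds]]] := hyp_i.
have T_lower r : references f Zr r -> alo (ref_dist r rd) <= T r.
  by move=> /T_bounds/andP[].
have [c1 [c2 [c1_gt0 c2_gt0 lbar_quad]]] := hyp_ii.
have [c3 [c4 [c3_gt0 c4_gt0 l_quad]]] := hyp_iii.
have [c5 [c6 [c5_gt0 c6_gt0 l_lin]]] := hyp_iv.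
have [cb [cf [kf [cb_gt0 cf_gt0 terminal]]]] := hyp_v.
have [c1r [c2r [c1r_gt0 c2r_gt0 improve]]] := hyp_vii.
have [DX hDX] := eucl_dist_sqr_bounded X_bounded.
have [DU hDU] := eucl_dist_sqr_bounded (compact_bounded U_compact).
have ref_bound r : references f Zr r -> ref_dist r rd ^+ 2 <= DX + DU.
  move=> /RefZ/Z_sub[Xr Ur]; have [Xd Ud] := Z_sub _ (RefZ _ rd_ref).
  by rewrite ref_dist_sqr lerD ?hDX ?hDU.
have D_ge0 : 0 <= DX + DU := le_trans (sqr_ge0 _) (ref_bound _ rd_ref).
(* One [theta = t] in (vii) serves all references, since their distances to [rd] are bounded. The
   first inequality yields [q_ball], using [t ^+ 2 <= t]; the second, multiplied by [t], yields
   [q_cost]. *)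
have [t [t0 t1 t_ball t_cost]] := exists_small_step
  (4 * c1r ^+ 2 * (DX + DU)) (4 * (cf * c2 * c1r ^+ 2)) (exprn_gt0 2 cb_gt0) c2r_gt0.
pose p := c2r * t; pose q := c1r ^+ 2 * t ^+ 2.
have p_gt0 : 0 < p by rewrite mulr_gt0.
have q_gt0 : 0 < q by rewrite mulr_gt0 ?exprn_gt0.
have ref_improve r : references f Zr r -> exists rhat,
    [/\ references f Zr rhat, ref_dist rhat r ^+ 2 <= q * ref_dist r rd ^+ 2
      & T rhat <= T r - p * ref_dist r rd ^+ 2].
  move=> rr; have [s [rs sr Ts]] := improve r t rr (ltW t0) t1.
  exists s; split=> //; last by rewrite /p; lra.
  rewrite /q -!exprMn ler_pXn2r ?nnegrE ?ref_dist_ge0 //.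
  by rewrite !mulr_ge0 ?ref_dist_ge0 // ltW.
have q_le_t : q <= c1r ^+ 2 * t.
  by rewrite ler_pM2l ?exprn_gt0 // expr2 ler_piMl // ltW.
have q_ball r : references f Zr r -> 4 * q * ref_dist r rd ^+ 2 <= cb ^+ 2.
  move=> /ref_bound rD; apply: le_trans t_ball.
  have -> : 4 * c1r ^+ 2 * (DX + DU) * t = 4 * (c1r ^+ 2 * t * (DX + DU)) by ring.
  rewrite -mulrA ler_pM2l //; apply: ler_pM => //; first exact: ltW.
  exact: sqr_ge0.
have q_cost : 4 * (cf * c2 * q) <= p.
  have -> : p = c2r * t by [].
  have : 4 * (cf * c2 * c1r ^+ 2) * t * t <= c2r * t by rewrite ler_pM2r.
  by rewrite /q expr2; lra.
have Xf_ball r : references f Zr r -> eucl_cball cb r.1 `<=` Xf r by move=> /terminal[].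
have Xf_inv r y : references f Zr r -> Xf r y -> Xf r (f (y, kf y r)).
  by move=> /terminal[_ H] /H[].
have Vf_decr r y : references f Zr r -> Xf r y ->
    Vf (f (y, kf y r)) r - Vf y r <= - l y (kf y r) r.
  by move=> /terminal[_ H] /H[].
have kf_Z r y : references f Zr r -> Xf r y -> Z (y, kf y r).
  by move=> /terminal[_ H] /H[].
have Vf_upper r y : references f Zr r -> Xf r y -> Vf y r <= cf * lbar y r.
  by move=> /terminal[_ H] /H[].
exact: (closed_loop_cost_limit Z_sub rd_ref T_rd T_ge0 lZ_ge0 lbar_le Vf_ge0 Xf_sub
  alo0 alo_incr T_lower c1_gt0 c2_gt0 c3_gt0 c4_gt0 c5_gt0 c6_gt0
  lbar_quad l_quad l_lin cb_gt0 cf_gt0 Xf_ball Xf_inv Vf_decr kf_Z Vf_upper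
  p_gt0 q_gt0 ref_improve q_ball q_cost hyp_vi.1 sol_opt fx).
Qed.
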